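(* Let $U$ be the forgetful functor from the category $(\infty,0)\text{-}\mathbb{C}\mathbb{E}\mathrm{tG}$ of cubical $\infty$-groupoidal stretchings to the category $\mathbb{C}\mathrm{Sets}$ of cubical sets, sending a stretching $(M,C,\pi,([-;-]^n_{n+1,j}),([-;-]^{n,\gamma}_{n+1,j}))$ to the underlying cubical set of $M$. Then $U$ has a left adjoint, and hence the adjunction produces a monad $\mathbb{W}^0=(W^0,\eta^0,\nu^0)$ on $\mathbb{C}\mathrm{Sets}$.
   Context: **Cubical sets.** A cubical set is a family of sets $(C_n)_{n\ge 0}$ with maps (sources and targets) $s^n_{n-1,j},t^n_{n-1,j}:C_n\to C_{n-1}$ for $n\ge1$, $1\le j\le n$, such that for $1\le i<j\le n$: $s^{n-1}_{n-2,i}s^n_{n-1,j}=s^{n-1}_{n-2,j-1}s^n_{n-1,i}$; $s^{n-1}_{n-2,i}t^n_{n-1,j}=t^{n-1}_{n-2,j-1}s^n_{n-1,i}$; $t^{n-1}_{n-2,i}s^n_{n-1,j}=s^{n-1}_{n-2,j-1}t^n_{n-1,i}$; $t^{n-1}_{n-2,i}t^n_{n-1,j}=t^{n-1}_{n-2,j-1}t^n_{n-1,i}$. Morphisms are families of maps commuting with all sources and targets. The category is $\mathbb{C}\mathrm{Sets}$. **Reflexive cubical sets.** A reflexive cubical set is a cubical set with maps $1^{n}_{n+1,j}:C_n\to C_{n+1}$ ($n\ge0$, $1\le j\le n+1$; classical reflexions) and $1^{n,\gamma}_{n+1,j}:C_n\to C_{n+1}$ ($n\ge1$, $1\le j\le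 n$, $\gamma\in\{+,-\}$; connections) such that, whenever the maps are defined (and with $r$ denoting either $s$ everywhere or $t$ everywhere): - $1^n_{n+1,i}1^{n-1}_{n,j}=1^n_{n+1,j+1}1^{n-1}_{n,i}$ for $1\le i\le j\le n$; - $r^n_{n-1,i}1^{n-1}_{n,j}=1^{n-2}_{n-1,j-1}r^{n-1}_{n-2,i}$ for $1\le i<j\le n$; $=1^{n-2}_{n-1,j}r^{n-1}_{n-2,i-1}$ for $1\le j<i\le n$; $=\mathrm{id}$ for $i=j$; - $1^{n,\gamma}_{n+1,i}1^{n-1,\gamma}_{n,j}=1^{n,\gamma}_{n+1,j+1}1^{n-1,\gamma}_{n,i}$ for $1\le i<j\le n-1$, and $1^{n,\gamma}_{n+1,i}1^{n-1,\gamma}_{n,i}=1^{n,\gamma}_{n+1,i+1}1^{n-1,\gamma}_{n,i}$ for $1\le i\le n-1$; - $1^{n,\gamma}_{n+1,i}1^{n-1}_{n,j}=1^n_{n+1,j+1}1^{n-1,\gamma}_{n,i}$ for $1\le i<j\le n$; $=1^n_{n+1,j}1^{n-1,\gamma}_{n,i-1}$ for $1\le j<i\le n$; and $1^{n,\gamma}_{n+1,j}1^{n-1}_{n,j}=1^n_{n+1,j}1^{n-1}_{n,j}$ for $1\le j\le n$; - $r^n_{n-1,i}1^{n-1,\gamma}_{n,j}=1^{n-2,\gamma}_{n-1,j-1}r^{n-1}_{n-2,i}$ for $1\le i<j\le n-1$; $=1^{n-2,\gamma}_{n-1,j}r^{n-1}_{n-2,i-1}$ for $2\le j+1<i\le n$;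 - for $1\le j\le n-1$: $s^n_{n-1,j}1^{n-1,-}_{n,j}=s^n_{n-1,j+1}1^{n-1,-}_{n,j}=\mathrm{id}$, $t^n_{n-1,j}1^{n-1,+}_{n,j}=t^n_{n-1,j+1}1^{n-1,+}_{n,j}=\mathrm{id}$, $s^n_{n-1,j}1^{n-1,+}_{n,j}=s^n_{n-1,j+1}1^{n-1,+}_{n,j}=1^{n-2}_{n-1,j}s^{n-1}_{n-2,j}$, $t^n_{n-1,j}1^{n-1,-}_{n,j}=t^n_{n-1,j+1}1^{n-1,-}_{n,j}=1^{n-2}_{n-1,j}t^{n-1}_{n-2,j}$. **Cubical reflexive $\infty$-magmas.** A reflexive cubical set with partial operations $\circ^n_j$ on $C_n$ ($n\ge1$, $1\le j\le n$), where $a\circ^n_jb$ is defined exactly when $t^n_{n-1,j}(a)=s^n_{n-1,j}(b)$, such that $s^n_{n-1,j}(a\circ^n_jb)=s^n_{n-1,j}(a)$, $t^n_{n-1,j}(a\circ^n_jb)=t^n_{n-1,j}(b)$, and for $r\in\{s,t\}$: $r^n_{n-1,i}(a\circ^n_jb)=r^n_{n-1,i}(a)\circ^{n-1}_{j-1}r^n_{n-1,i}(b)$ if $i<j$, and $=r^n_{n-1,i}(a)\circ^{n-1}_{j}r^n_{n-1,i}(b)$ if $j<i$. Morphisms are maps commuting with sources, targets, reflexions, connections and the operations $\circ^n_j$. **Strict cubical $\infty$-categories.** A strict cubical $\infty$-category is a cubical reflexive $\infty$-magma such that the operations are associative and unital ($1^{n-1}_{n,j}(s^n_{n-1,j}(a))\circ^n_ja=a=a\circ^n_j1^{n-1}_{n,j}(t^n_{n-1,j}(a))$),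 and such that: - interchange: $(a\circ^n_ib)\circ^n_j(c\circ^n_id)=(a\circ^n_jc)\circ^n_i(b\circ^n_jd)$ for $i\ne j$ whenever both sides are defined; - $1^n_{n+1,i}(a\circ^n_jb)=1^n_{n+1,i}(a)\circ^{n+1}_{j+1}1^n_{n+1,i}(b)$ if $1\le i\le j\le n$, and $=1^n_{n+1,i}(a)\circ^{n+1}_j1^n_{n+1,i}(b)$ if $1\le j<i\le n+1$; - $1^{n,\gamma}_{n+1,i}(a\circ^n_jb)=1^{n,\gamma}_{n+1,i}(a)\circ^{n+1}_{j+1}1^{n,\gamma}_{n+1,i}(b)$ if $1\le i<j\le n$, and $=1^{n,\gamma}_{n+1,i}(a)\circ^{n+1}_j1^{n,\gamma}_{n+1,i}(b)$ if $1\le j<i\le n$; - transport laws, for $1\le j\le n$: $1^{n,+}_{n+1,j}(a\circ^n_jb)=\bigl(1^{n,+}_{n+1,j}(a)\circ^{n+1}_j1^n_{n+1,j}(a)\bigr)\circ^{n+1}_{j+1}\bigl(1^n_{n+1,j+1}(a)\circ^{n+1}_j1^{n,+}_{n+1,j}(b)\bigr)$ and $1^{n,-}_{n+1,j}(a\circ^n_jb)=\bigl(1^{n,-}_{n+1,j}(a)\circ^{n+1}_j1^n_{n+1,j+1}(b)\bigr)\circ^{n+1}_{j+1}\bigl(1^n_{n+1,j}(b)\circ^{n+1}_j1^{n,-}_{n+1,j}(b)\bigr)$; - for $1\le i\le n$: $1^{n,+}_{n+1,i}(x)\circ^{n+1}_i1^{n,-}_{n+1,i}(x)=1^n_{n+1,i+1}(x)$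 and $1^{n,+}_{n+1,i}(x)\circ^{n+1}_{i+1}1^{n,-}_{n+1,i}(x)=1^n_{n+1,i}(x)$. **$(\infty,0)$-structures, groupoids, $(\infty,0)$-magmas.** An $(\infty,0)$-structure on a cubical set $\mathcal C$ is a family of maps (reversors) $j^n_j:C_n\to C_n$ ($n\ge1$, $1\le j\le n$) with $t^n_{n-1,j}\circ j^n_j=s^n_{n-1,j}$ and $s^n_{n-1,j}\circ j^n_j=t^n_{n-1,j}$. A cubical strict $\infty$-groupoid is a strict cubical $\infty$-category whose underlying cubical set is equipped with an $(\infty,0)$-structure such that for all $n\ge1$, $1\le j\le n$, $\alpha\in C_n$: $\alpha\circ^n_jj^n_j(\alpha)=1^{n-1}_{n,j}(s^n_{n-1,j}(\alpha))$ and $j^n_j(\alpha)\circ^n_j\alpha=1^{n-1}_{n,j}(t^n_{n-1,j}(\alpha))$. A cubical reflexive $(\infty,0)$-magma is a cubical reflexive $\infty$-magma whose underlying cubical set is equipped with an $(\infty,0)$-structure; morphisms are morphisms of cubical reflexive $\infty$-magmas commuting with all reversors. The category is $(\infty,0)\text{-}\mathbb{C}\mathbb{M}\mathrm{ag}_r$. **Cubical $\infty$-groupoidal stretchings.** An object of $(\infty,0)\text{-}\mathbb{C}\mathbb{E}\mathrm{tG}$ is a quintuple $(M,C,\pi,([-;-]^n_{n+1,j})_{n\ge0,1\le j\le n+1},([-;-]^{n,\gamma}_{n+1,j})_{n\ge1,1\le j\le n,\gamma\in\{-,+\}})$ with $M$ a cubical reflexive $(\infty,0)$-magma, $C$ a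 cubical strict $\infty$-groupoid, $\pi:M\to C$ a morphism of $(\infty,0)\text{-}\mathbb{C}\mathbb{M}\mathrm{ag}_r$, and bracketing maps as follows. Put $\underline{M}_0=\{(\alpha,\beta)\in M_0\times M_0:\alpha=\beta\}$ and for $n\ge1$, $\underline{M}_n=\{(\alpha,\beta)\in M_n\times M_n:\pi_n(\alpha)=\pi_n(\beta)\}$, $\underline{M}^s_{n,j}=\{(\alpha,\beta)\in\underline{M}_n:s^n_{n-1,j}(\alpha)=s^n_{n-1,j}(\beta)\}$, $\underline{M}^t_{n,j}=\{(\alpha,\beta)\in\underline{M}_n:t^n_{n-1,j}(\alpha)=t^n_{n-1,j}(\beta)\}$. The brackets are maps $[-;-]^n_{n+1,j}:\underline{M}_n\to M_{n+1}$, $[-;-]^{n,-}_{n+1,j}:\underline{M}^s_{n,j}\to M_{n+1}$, $[-;-]^{n,+}_{n+1,j}:\underline{M}^t_{n,j}\to M_{n+1}$ satisfying (each equation includes the requirement that the brackets in it be defined; $r\in\{s,t\}$): - $r^{n+1}_{n,i}([\alpha;\beta]^n_{n+1,j})=[r^n_{n-1,i}(\alpha);r^n_{n-1,i}(\beta)]^{n-1}_{n,j-1}$ if $1\le i<j\le n+1$; $=[r^n_{n-1,i-1}(\alpha);r^n_{n-1,i-1}(\beta)]^{n-1}_{n,j}$ if $1\le j<i\le n+1$; $s^{n+1}_{n,j}([\alpha;\beta]^n_{n+1,j})=\alpha$ and $t^{n+1}_{n,j}([\alpha;\beta]^n_{n+1,j})=\beta$; - $\pi_{n+1}([\alpha;\beta]^n_{n+1,j})=1^n_{n+1,j}(\pi_n(\alpha))=1^n_{n+1,j}(\pi_n(\beta))$,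 and $[\alpha;\alpha]^n_{n+1,j}=1^n_{n+1,j}(\alpha)$ for all $\alpha\in M_n$; - for $1\le j\le n$: $s^{n+1}_{n,j}([\alpha;\beta]^{n,-}_{n+1,j})=\alpha$, $s^{n+1}_{n,j+1}([\alpha;\beta]^{n,-}_{n+1,j})=\beta$, $t^{n+1}_{n,j}([\alpha;\beta]^{n,+}_{n+1,j})=\alpha$, $t^{n+1}_{n,j+1}([\alpha;\beta]^{n,+}_{n+1,j})=\beta$, $s^{n+1}_{n,j}([\alpha;\beta]^{n,+}_{n+1,j})=s^{n+1}_{n,j+1}([\alpha;\beta]^{n,+}_{n+1,j})=[s^n_{n-1,j}(\alpha);s^n_{n-1,j}(\beta)]^{n-1}_{n,j}$, $t^{n+1}_{n,j}([\alpha;\beta]^{n,-}_{n+1,j})=t^{n+1}_{n,j+1}([\alpha;\beta]^{n,-}_{n+1,j})=[t^n_{n-1,j}(\alpha);t^n_{n-1,j}(\beta)]^{n-1}_{n,j}$; - $r^{n+1}_{n,i}([\alpha;\beta]^{n,\gamma}_{n+1,j})=[r^n_{n-1,i}(\alpha);r^n_{n-1,i}(\beta)]^{n-1,\gamma}_{n,j-1}$ if $1\le i<j\le n$; $=[r^n_{n-1,i-1}(\alpha);r^n_{n-1,i-1}(\beta)]^{n-1,\gamma}_{n,j}$ if $2\le j+1<i\le n+1$; - $\pi_{n+1}([\alpha;\beta]^{n,\gamma}_{n+1,j})=1^{n,\gamma}_{n+1,j}(\pi_n(\alpha))=1^{n,\gamma}_{n+1,j}(\pi_n(\beta))$, and $[\alpha;\alpha]^{n,\gamma}_{n+1,j}=1^{n,\gamma}_{n+1,j}(\alpha)$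 for all $\alpha\in M_n$. A morphism from $(M,C,\pi,\dots)$ to $(M',C',\pi',\dots)$ is a pair $(m,c)$ of morphisms $m:M\to M'$, $c:C\to C'$ of $(\infty,0)\text{-}\mathbb{C}\mathbb{M}\mathrm{ag}_r$ with $\pi'm=c\pi$, such that $m_{n+1}([\alpha;\beta]^n_{n+1,j})=[m_n(\alpha);m_n(\beta)]^n_{n+1,j}$ and $m_{n+1}([\alpha;\beta]^{n,\gamma}_{n+1,j})=[m_n(\alpha);m_n(\beta)]^{n,\gamma}_{n+1,j}$ for all pairs in the respective domains. *)

(* Defs.v *)
From mathcomp Require Import all_boot.
From Stdlib Require Import FunctionalExtensionality ProofIrrelevance.

Unset Implicit Arguments.

(** * Categories, adjunctions, monads *)

Record Category := {
  Ob :> Type;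
  Hom : Ob -> Ob -> Type;
  idc : forall {A}, Hom A A;
  compc : forall {A B C}, Hom B C -> Hom A B -> Hom A C;
  compc_idl : forall A B (f : Hom A B), compc idc f = f;
  compc_idr : forall A B (f : Hom A B), compc f idc = f;
  compcA : forall A B C D (h : Hom C D) (g : Hom B C) (f : Hom A B),
      compc h (compc g f) = compc (compc h g) f }.

Arguments Hom {_} _ _.
Arguments idc {_} A.
Arguments compc {_ A B C} _ _.

Notation "g ∘ f" := (compc g f) (at level 40, left associativity).

Record Functor (C D : Category) := {
  fobj :> C -> D;
  fmap : forall {A B : C}, Hom A B -> Hom (fobj A) (fobj B);
  fmap_id : forall A : C, fmap (idc A) = idc (fobj A);
  fmap_comp : forall (A B E : C) (g : Hom B E) (f : Hom A B),
      fmap (g ∘ f) = fmap g ∘ fmap f }.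

Arguments fmap {_ _} _ {_ _} _.

Arguments fmap_id {_ _} _ A.
Arguments fmap_comp {_ _} _ {A B E} g f.

Definition idF (C : Category) : Functor C C.
Proof. by exists (fun A => A) (fun _ _ f => f). Defined.

Definition compF {C D E : Category} (G : Functor D E) (F : Functor C D) :
  Functor C E.
Proof.
exists (fun A => G (F A)) (fun _ _ f => fmap G (fmap F f)).
- by move=> A; rewrite !fmap_id.
- by move=> A B K g f; rewrite !fmap_comp.
Defined.

Record NatTrans {C D : Category} (F G : Functor C D) := {
  ntc :> forall A : C, Hom (F A) (G A);
  nt_nat : forall (A B : C) (f : Hom A B), ntc B ∘ fmap F f = fmap G f ∘ ntc A }.

Arguments ntc {_ _ _ _} _ A.
Arguments nt_nat {_ _ _ _} _ {A B} f.

(** [IsAdjunction eta eps] : [F] is left adjoint to [U], with unit [eta] and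
    counit [eps]. *)
Record IsAdjunction {C D : Category} {F : Functor C D} {U : Functor D C}
    (eta : NatTrans (idF C) (compF U F)) (eps : NatTrans (compF F U) (idF D)) :
    Prop := {
  adj_triangleF : forall A : C, eps (F A) ∘ fmap F (eta A) = idc (F A);
  adj_triangleU : forall B : D, fmap U (eps B) ∘ eta (U B) = idc (U B) }.

Record IsMonad {C : Category} {T : Functor C C}
    (eta : NatTrans (idF C) T) (mu : NatTrans (compF T T) T) : Prop := {
  monad_assoc : forall A : C, mu A ∘ fmap T (mu A) = mu A ∘ mu (T A);
  monad_unitl : forall A : C, mu A ∘ eta (T A) = idc (T A);
  monad_unitr : forall A : C, mu A ∘ fmap T (eta A) = idc (T A) }.

(** The multiplication [U eps F] on [U F]. *)
Definition adj_mult {C D : Category} {F : Functor C D} {U : Functor D C}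
    (eps : NatTrans (compF F U) (idF D)) :
  NatTrans (compF (compF U F) (compF U F)) (compF U F).
Proof.
exists (fun A : C => fmap U (eps (F A))).
move=> A B f /=.
by rewrite -!fmap_comp; congr fmap; exact: (nt_nat eps (fmap F f)).
Defined.

(** * Cubical sets *)

(** Directions are elements of ['I_n.+1]. [ix j] is the direction with 1-based
    number [j]; it is only used for [1 <= j <= n.+1], outside of which [inord]
    returns a default value. *)
Definition ix {n : nat} (j : nat) : 'I_n.+1 := inord j.-1.

Inductive side := Src | Tgt.
Inductive sign := Plus | Minus.

(** The connection of sign [g] has identity faces on [side_of g] and degenerate
    faces on [coside_of g]. *)
Definition side_of (g : sign) : side :=
  match g with Minus => Src | Plus => Tgt end.
Definition coside_of (g : sign) : side :=
  match g with Minus => Tgt | Plus => Src end.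

(** [face Src] and [face Tgt] are the sources and the targets. *)
Record CSet := {
  cell :> nat -> Type;
  face : forall (r : side) {n}, 'I_n.+1 -> cell n.+1 -> cell n;
  face_face : forall (r r' : side) n (i j : nat) (x : cell n.+2),
    1 <= i -> i < j <= n.+2 ->
    face r (ix i) (face r' (ix j) x) = face r' (ix j.-1) (face r (ix i) x) }.

Arguments face {_} r {n} j x.

Record CSetHom (C D : CSet) := {
  hmap :> forall {n}, C n -> D n;
  hmap_face : forall r n (j : 'I_n.+1) (x : C n.+1),
    hmap (face r j x) = face r j (hmap x) }.

Arguments hmap {C D} _ {n} _.

(** ** Reflexive cubical sets *)

Record RCSet := {
  rcset :> CSet;
  refl : forall {n}, 'I_n.+1 -> rcset n -> rcset n.+1;
  conn : forall (g : sign) {n}, 'I_n.+1 -> rcset n.+1 -> rcset n.+2;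

  refl_refl : forall n (i j : nat) (x : rcset n),
    1 <= i -> i <= j <= n.+1 ->
    refl (ix i) (refl (ix j) x) = refl (ix j.+1) (refl (ix i) x);

  face_refl_lt : forall r n (i j : nat) (x : rcset n.+1),
    1 <= i -> i < j <= n.+2 ->
    face r (ix i) (refl (ix j) x) = refl (ix j.-1) (face r (ix i) x);
  face_refl_gt : forall r n (i j : nat) (x : rcset n.+1),
    1 <= j -> j < i <= n.+2 ->
    face r (ix i) (refl (ix j) x) = refl (ix j) (face r (ix i.-1) x);
  face_refl_eq : forall r n (j : 'I_n.+1) (x : rcset n),
    face r j (refl j x) = x;

  conn_conn_lt : forall g n (i j : nat) (x : rcset n.+1),
    1 <= i -> i < j <= n.+1 ->
    conn g (ix i) (conn g (ix j) x) = conn g (ix j.+1) (conn g (ix i) x);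
  conn_conn_eq : forall g n (i : nat) (x : rcset n.+1),
    1 <= i <= n.+1 ->
    conn g (ix i) (conn g (ix i) x) = conn g (ix i.+1) (conn g (ix i) x);

  conn_refl_lt : forall g n (i j : nat) (x : rcset n.+1),
    1 <= i -> i < j <= n.+2 ->
    conn g (ix i) (refl (ix j) x) = refl (ix j.+1) (conn g (ix i) x);
  conn_refl_gt : forall g n (i j : nat) (x : rcset n.+1),
    1 <= j -> j < i <= n.+2 ->
    conn g (ix i) (refl (ix j) x) = refl (ix j) (conn g (ix i.-1) x);
  conn_refl_eq : forall g n (j : nat) (x : rcset n),
    1 <= j <= n.+1 ->
    conn g (ix j) (refl (ix j) x) = refl (ix j) (refl (ix j) x);

  face_conn_lt : forall r g n (i j : nat) (x : rcset n.+2),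
    1 <= i -> i < j <= n.+2 ->
    face r (ix i) (conn g (ix j) x) = conn g (ix j.-1) (face r (ix i) x);
  face_conn_gt : forall r g n (i j : nat) (x : rcset n.+2),
    1 <= j -> j.+1 < i <= n.+3 ->
    face r (ix i) (conn g (ix j) x) = conn g (ix j) (face r (ix i.-1) x);

  face_conn_side : forall g n (j : nat) (x : rcset n.+1),
    1 <= j <= n.+1 ->
    face (side_of g) (ix j) (conn g (ix j) x) = x /\
    face (side_of g) (ix j.+1) (conn g (ix j) x) = x;
  face_conn_coside : forall g n (j : nat) (x : rcset n.+1),
    1 <= j <= n.+1 ->
    face (coside_of g) (ix j) (conn g (ix j) x)
      = refl (ix j) (face (coside_of g) (ix j) x) /\
    face (coside_of g) (ix j.+1) (conn g (ix j) x)
      = refl (ix j) (face (coside_of g) (ix j) x) }.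

Arguments refl {_ n} j x.
Arguments conn {_} g {n} j x.

(** ** Cubical reflexive ∞-magmas *)

(** [comp j a b h] is [a ∘_j b]. Partial operations carry a proof that their
    arguments are in the domain; in the laws below, [exists h] says that the
    right-hand side is defined. *)
Record Magma := {
  mrcset :> RCSet;
  comp : forall {n} (j : 'I_n.+1) (a b : mrcset n.+1),
    face Tgt j a = face Src j b -> mrcset n.+1;

  src_comp : forall n (j : 'I_n.+1) (a b : mrcset n.+1) h,
    face Src j (comp j a b h) = face Src j a;
  tgt_comp : forall n (j : 'I_n.+1) (a b : mrcset n.+1) h,
    face Tgt j (comp j a b h) = face Tgt j b;
  face_comp_lt : forall r n (i j : nat) (a b : mrcset n.+2) h,
    1 <= i -> i < j <= n.+2 ->
    exists h', face r (ix i) (comp (ix j) a b h)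
      = comp (ix j.-1) (face r (ix i) a) (face r (ix i) b) h';
  face_comp_gt : forall r n (i j : nat) (a b : mrcset n.+2) h,
    1 <= j -> j < i <= n.+2 ->
    exists h', face r (ix i) (comp (ix j) a b h)
      = comp (ix j) (face r (ix i) a) (face r (ix i) b) h' }.

Arguments comp {_ n} j a b h.

Record MagmaHom (M N : Magma) := {
  mhom :> CSetHom M N;
  mhom_refl : forall n (j : 'I_n.+1) (x : M n),
    mhom _ (refl j x) = refl j (mhom _ x);
  mhom_conn : forall g n (j : 'I_n.+1) (x : M n.+1),
    mhom _ (conn g j x) = conn g j (mhom _ x);
  mhom_comp : forall n (j : 'I_n.+1) (a b : M n.+1) h,
    exists h', mhom _ (comp j a b h) = comp j (mhom _ a) (mhom _ b) h' }.

(** ** Strict cubical ∞-categories *)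

Record StrictCat := {
  scmagma :> Magma;

  sc_assoc : forall n (j : 'I_n.+1) (a b c : scmagma n.+1) hab hbc,
    exists h h',
      comp j (comp j a b hab) c h = comp j a (comp j b c hbc) h';
  sc_unitl : forall n (j : 'I_n.+1) (a : scmagma n.+1),
    exists h, comp j (refl j (face Src j a)) a h = a;
  sc_unitr : forall n (j : 'I_n.+1) (a : scmagma n.+1),
    exists h, comp j a (refl j (face Tgt j a)) h = a;

  sc_interchange : forall n (i j : 'I_n.+1) (a b c d : scmagma n.+1)
      hab hcd hac hbd h h',
    i <> j ->
    comp j (comp i a b hab) (comp i c d hcd) h
      = comp i (comp j a c hac) (comp j b d hbd) h';

  sc_refl_comp_le : forall n (i j : nat) (a b : scmagma n.+1) h,
    1 <= i -> i <= j <= n.+1 ->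
    exists h', refl (ix i) (comp (ix j) a b h)
      = comp (ix j.+1) (refl (ix i) a) (refl (ix i) b) h';
  sc_refl_comp_gt : forall n (i j : nat) (a b : scmagma n.+1) h,
    1 <= j -> j < i <= n.+2 ->
    exists h', refl (ix i) (comp (ix j) a b h)
      = comp (ix j) (refl (ix i) a) (refl (ix i) b) h';

  sc_conn_comp_lt : forall g n (i j : nat) (a b : scmagma n.+1) h,
    1 <= i -> i < j <= n.+1 ->
    exists h', conn g (ix i) (comp (ix j) a b h)
      = comp (ix j.+1) (conn g (ix i) a) (conn g (ix i) b) h';
  sc_conn_comp_gt : forall g n (i j : nat) (a b : scmagma n.+1) h,
    1 <= j -> j < i <= n.+1 ->
    exists h', conn g (ix i) (comp (ix j) a b h)
      = comp (ix j) (conn g (ix i) a) (conn g (ix i) b) h';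

  sc_transport_plus : forall n (j : nat) (a b : scmagma n.+1) h,
    1 <= j <= n.+1 ->
    exists h1 h2 h3, conn Plus (ix j) (comp (ix j) a b h)
      = comp (ix j.+1)
          (comp (ix j) (conn Plus (ix j) a) (refl (ix j) a) h1)
          (comp (ix j) (refl (ix j.+1) a) (conn Plus (ix j) b) h2) h3;
  sc_transport_minus : forall n (j : nat) (a b : scmagma n.+1) h,
    1 <= j <= n.+1 ->
    exists h1 h2 h3, conn Minus (ix j) (comp (ix j) a b h)
      = comp (ix j.+1)
          (comp (ix j) (conn Minus (ix j) a) (refl (ix j.+1) b) h1)
          (comp (ix j) (refl (ix j) b) (conn Minus (ix j) b) h2) h3;

  sc_conn_conn : forall n (i : nat) (x : scmagma n.+1),
    1 <= i <= n.+1 ->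
    exists h, comp (ix i) (conn Plus (ix i) x) (conn Minus (ix i) x) h
      = refl (ix i.+1) x;
  sc_conn_conn_succ : forall n (i : nat) (x : scmagma n.+1),
    1 <= i <= n.+1 ->
    exists h, comp (ix i.+1) (conn Plus (ix i) x) (conn Minus (ix i) x) h
      = refl (ix i) x }.

(** ** (∞,0)-structures *)

(** The field [reversor] is the family of reversors [j^n_j]. *)
Record Inf0Structure (C : CSet) := {
  reversor :> forall {n}, 'I_n.+1 -> C n.+1 -> C n.+1;
  tgt_reversor : forall n (j : 'I_n.+1) (x : C n.+1),
    face Tgt j (reversor j x) = face Src j x;
  src_reversor : forall n (j : 'I_n.+1) (x : C n.+1),
    face Src j (reversor j x) = face Tgt j x }.

Arguments reversor {C} _ {n} j x.

Record Magma0 := {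
  m0magma :> Magma;
  m0rev : Inf0Structure m0magma }.

Definition rev {M : Magma0} {n} (j : 'I_n.+1) (x : M n.+1) : M n.+1 :=
  reversor (m0rev M) j x.

Record Magma0Hom (M N : Magma0) := {
  m0hom :> MagmaHom M N;
  m0hom_rev : forall n (j : 'I_n.+1) (x : M n.+1),
    m0hom _ (rev j x) = rev j (m0hom _ x) }.

Record Groupoid := {
  gcat :> StrictCat;
  grev : Inf0Structure gcat;
  grev_invr : forall n (j : 'I_n.+1) (x : gcat n.+1),
    exists h, comp j x (reversor grev j x) h = refl j (face Src j x);
  grev_invl : forall n (j : 'I_n.+1) (x : gcat n.+1),
    exists h, comp j (reversor grev j x) x h = refl j (face Tgt j x) }.

Definition groupoid_magma0 (C : Groupoid) : Magma0 :=
  {| m0magma := C; m0rev := grev C |}.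

Coercion groupoid_magma0 : Groupoid >-> Magma0.

(** ** Cubical ∞-groupoidal stretchings *)

(** Membership of [(a, b)] in the domain of the brackets on [n]-cells. *)
Definition parallel {M N : Magma0} (p : Magma0Hom M N) {n} :
    M n -> M n -> Prop :=
  match n with
  | 0 => fun a b => a = b
  | m.+1 => fun a b => p m.+1 a = p m.+1 b
  end.

(** [br j a b h] is [[a;b]^n_{n+1,j}] and [cbr g j a b h hs] is
    [[a;b]^{n,g}_{n+1,j}]. *)
Record Stretching := {
  stM : Magma0;
  stC : Groupoid;
  stpi : Magma0Hom stM stC;
  br : forall {n} (j : 'I_n.+1) (a b : stM n), parallel stpi a b -> stM n.+1;
  cbr : forall (g : sign) {n} (j : 'I_n.+1) (a b : stM n.+1),
    parallel stpi a b -> face (side_of g) j a = face (side_of g) j b ->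
    stM n.+2;

  face_br_lt : forall r n (i j : nat) (a b : stM n.+1) h,
    1 <= i -> i < j <= n.+2 ->
    exists h', face r (ix i) (br (ix j) a b h)
      = br (ix j.-1) (face r (ix i) a) (face r (ix i) b) h';
  face_br_gt : forall r n (i j : nat) (a b : stM n.+1) h,
    1 <= j -> j < i <= n.+2 ->
    exists h', face r (ix i) (br (ix j) a b h)
      = br (ix j) (face r (ix i.-1) a) (face r (ix i.-1) b) h';
  src_br : forall n (j : 'I_n.+1) (a b : stM n) h,
    face Src j (br j a b h) = a;
  tgt_br : forall n (j : 'I_n.+1) (a b : stM n) h,
    face Tgt j (br j a b h) = b;
  pi_br : forall n (j : 'I_n.+1) (a b : stM n) h,
    stpi _ (br j a b h) = refl j (stpi _ a) /\
    stpi _ (br j a b h) = refl j (stpi _ b);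
  br_diag : forall n (j : 'I_n.+1) (a : stM n),
    exists h, br j a a h = refl j a;

  face_cbr_side : forall g n (j : nat) (a b : stM n.+1) h hs,
    1 <= j <= n.+1 ->
    face (side_of g) (ix j) (cbr g (ix j) a b h hs) = a /\
    face (side_of g) (ix j.+1) (cbr g (ix j) a b h hs) = b;
  face_cbr_coside : forall g n (j : nat) (a b : stM n.+1) h hs,
    1 <= j <= n.+1 ->
    exists h',
      face (coside_of g) (ix j) (cbr g (ix j) a b h hs)
        = br (ix j) (face (coside_of g) (ix j) a)
                    (face (coside_of g) (ix j) b) h' /\
      face (coside_of g) (ix j.+1) (cbr g (ix j) a b h hs)
        = br (ix j) (face (coside_of g) (ix j) a)
                    (face (coside_of g) (ix j) b) h';
  face_cbr_lt : forall r g n (i j : nat) (a b : stM n.+2) h hs,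
    1 <= i -> i < j <= n.+2 ->
    exists h' hs', face r (ix i) (cbr g (ix j) a b h hs)
      = cbr g (ix j.-1) (face r (ix i) a) (face r (ix i) b) h' hs';
  face_cbr_gt : forall r g n (i j : nat) (a b : stM n.+2) h hs,
    1 <= j -> j.+1 < i <= n.+3 ->
    exists h' hs', face r (ix i) (cbr g (ix j) a b h hs)
      = cbr g (ix j) (face r (ix i.-1) a) (face r (ix i.-1) b) h' hs';
  pi_cbr : forall g n (j : 'I_n.+1) (a b : stM n.+1) h hs,
    stpi _ (cbr g j a b h hs) = conn g j (stpi _ a) /\
    stpi _ (cbr g j a b h hs) = conn g j (stpi _ b);
  cbr_diag : forall g n (j : 'I_n.+1) (a : stM n.+1),
    exists h hs, cbr g j a a h hs = conn g j a }.

Arguments br {_ n} j a b h.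
Arguments cbr {_} g {n} j a b h hs.

Record StretchingHom (S T : Stretching) := {
  sthomM : Magma0Hom (stM S) (stM T);
  sthomC : Magma0Hom (stC S) (stC T);
  sthom_pi : forall n (x : stM S n),
    stpi T _ (sthomM _ x) = sthomC _ (stpi S _ x);
  sthom_br : forall n (j : 'I_n.+1) (a b : stM S n) h,
    exists h', sthomM _ (br j a b h) = br j (sthomM _ a) (sthomM _ b) h';
  sthom_cbr : forall g n (j : 'I_n.+1) (a b : stM S n.+1) h hs,
    exists h' hs',
      sthomM _ (cbr g j a b h hs) = cbr g j (sthomM _ a) (sthomM _ b) h' hs' }.

Arguments sthomM {S T} _.
Arguments sthomC {S T} _.

(** ** The categories and the forgetful functor *)

Lemma CSetHom_eq (C D : CSet) (f g : CSetHom C D) :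
  (forall n (x : C n), f n x = g n x) -> f = g.
Proof.
case: f g => [f hf] [g hg] /= e.
have efg : f = g.
  by apply: functional_extensionality_dep => n; apply: functional_extensionality.
by case: g / efg hg e => hg _; congr Build_CSetHom; apply: proof_irrelevance.
Qed.

Lemma MagmaHom_eq (M N : Magma) (f g : MagmaHom M N) :
  mhom M N f = mhom M N g -> f = g.
Proof.
case: f g => [f f1 f2 f3] [g g1 g2 g3] /= e.
case: g / e g1 g2 g3 => g1 g2 g3.
by congr Build_MagmaHom; apply: proof_irrelevance.
Qed.

Lemma Magma0Hom_eq (M N : Magma0) (f g : Magma0Hom M N) :
  (forall n (x : M n), f n x = g n x) -> f = g.
Proof.
move=> e; have {e} : m0hom M N f = m0hom M N g.
  by apply: MagmaHom_eq; apply: CSetHom_eq.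
case: f g => [f f1] [g g1] /= e; case: g / e g1 => g1.
by congr Build_Magma0Hom; apply: proof_irrelevance.
Qed.

Lemma StretchingHom_eq (S T : Stretching) (f g : StretchingHom S T) :
  sthomM f = sthomM g -> sthomC f = sthomC g -> f = g.
Proof.
case: f g => [f c f1 f2 f3] [g d g1 g2 g3] /= e e'.
case: g / e g1 g2 g3; case: d / e' => g1 g2 g3.
by congr Build_StretchingHom; apply: proof_irrelevance.
Qed.

Definition CSetHom_id (C : CSet) : CSetHom C C.
Proof. by exists (fun n x => x). Defined.

Definition CSetHom_comp {C D E : CSet} (g : CSetHom D E) (f : CSetHom C D) :
  CSetHom C E.
Proof.
exists (fun n x => g n (f n x)).
by move=> r n j x; rewrite !hmap_face.
Defined.

Definition MagmaHom_id (M : Magma) : MagmaHom M M.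
Proof. by exists (CSetHom_id M) => // n j a b h; exists h. Defined.

Definition MagmaHom_comp {M N P : Magma} (g : MagmaHom N P)
    (f : MagmaHom M N) : MagmaHom M P.
Proof.
exists (CSetHom_comp g f) => /=.
- by move=> n j x; rewrite !mhom_refl.
- by move=> s n j x; rewrite !mhom_conn.
- move=> n j a b h; have [h1 ->] := mhom_comp _ _ f n j a b h.
  exact: mhom_comp.
Defined.

Definition Magma0Hom_id (M : Magma0) : Magma0Hom M M.
Proof. by exists (MagmaHom_id M). Defined.

Definition Magma0Hom_comp {M N P : Magma0} (g : Magma0Hom N P)
    (f : Magma0Hom M N) : Magma0Hom M P.
Proof.
exists (MagmaHom_comp g f).
by move=> n j x /=; rewrite !m0hom_rev.
Defined.

Definition StretchingHom_id (S : Stretching) : StretchingHom S S.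
Proof.
exists (Magma0Hom_id _) (Magma0Hom_id _) => //=.
- by move=> n j a b h; exists h.
- by move=> g n j a b h hs; exists h, hs.
Defined.

Definition StretchingHom_comp {S T V : Stretching} (g : StretchingHom T V)
    (f : StretchingHom S T) : StretchingHom S V.
Proof.
exists (Magma0Hom_comp (sthomM g) (sthomM f))
       (Magma0Hom_comp (sthomC g) (sthomC f)) => /=.
- by move=> n x; rewrite !sthom_pi.
- move=> n j a b h; have [h1 ->] := sthom_br _ _ f n j a b h.
  exact: sthom_br.
- move=> s n j a b h hs; have [h1 [hs1 ->]] := sthom_cbr _ _ f s n j a b h hs.
  exact: sthom_cbr.
Defined.

Definition CSets : Category.
Proof.
by refine {| Ob := CSet; Hom := CSetHom; idc := CSetHom_id;
             compc := @CSetHom_comp |} => *; apply: CSetHom_eq.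
Defined.

Definition EtG : Category.
Proof.
by refine {| Ob := Stretching; Hom := StretchingHom; idc := StretchingHom_id;
             compc := @StretchingHom_comp |} => *;
  apply: StretchingHom_eq; apply: Magma0Hom_eq.
Defined.

Definition forgetful : Functor EtG CSets.
Proof.
by refine {| fobj := (fun S : EtG => stM S : CSets);
             fmap := fun S T (f : Hom S T) => (sthomM f : CSetHom _ _) |}.
Defined.

(* Main.v *)
From mathcomp Require Import all_boot.
From Stdlib Require Import ProofIrrelevance FunctionalExtensionality.
From Stdlib Require Import PropExtensionality ClassicalEpsilon.
Require Import Defs.

(** By the universal property of a left adjoint it is enough to construct, for
    every cubical set [X], a stretching [fstretching X] and a cubical map
    [unit_hom X] into its total part through which every cubical map from [X]
    to a stretching factors uniquely ([ext_hom], [hom_unit_inj]); the functor,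
    the unit and counit, the triangle identities and the monad laws then follow
    formally.

    Stretchings are the models of a two-sorted essentially algebraic theory:
    the operations are total or partial, the domain of a partial one is given
    by equations between previously defined terms, and the axioms are
    conditional equations.  So the free stretching is made of formal terms in
    the generators [X], taken up to provable equality.  Instead of a calculus
    of proofs, equality is defined semantically.  A term has at most one value
    along a map [f] from [X] to a stretching [S] ([den_fun]); it is kept when
    it has a value along every such [f], and two terms are identified when
    they have the same value along every [f].  This quantification over all
    stretchings is harmless because it stays in [Prop], while the terms
    themselves are as small as [X].  It amounts to taking the substructure
    generated by [X] in the product of all pairs [(S, f)], a product which is
    itself too large to be formed.

    Two principles then do all the work.  Cells of the free stretching are
    equal as soon as all their values are ([fcellP]), and a composite or a
    bracket of cells exists in it as soon as it exists for all their values
    ([fcompP], [fbrP], [fcbrP]).  Hence each axiom of stretchings holds in the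
    free one because it holds in every [S].

    Taking values along [f] is a morphism extending [f].  For uniqueness, the
    free stretching is itself one of the stretchings quantified over, so each
    of its cells is the value of a term along the unit ([den_unit]); morphisms
    preserve values of terms ([den_hom]), hence are determined by their
    restriction to the generators. *)

(** * Adjunctions from universal arrows *)

Section UniversalArrows.

Variables (C D : Category) (U : Functor D C) (F0 : C -> D).
Variable eta0 : forall A : C, Hom A (U (F0 A)).
Variable lift : forall (A : C) (B : D), Hom A (U B) -> Hom (F0 A) B.
Hypothesis lift_eta : forall A B (f : Hom A (U B)),
  fmap U (lift A B f) ∘ eta0 A = f.
Hypothesis hom_eta_inj : forall A B (g h : Hom (F0 A) B),
  fmap U g ∘ eta0 A = fmap U h ∘ eta0 A -> g = h.

Definition free_functor : Functor C D.
Proof.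
exists F0 (fun A B f => lift A (F0 B) (eta0 B ∘ f)).
- by move=> A; apply: hom_eta_inj; rewrite lift_eta fmap_id compc_idl compc_idr.
- move=> A B E g f; apply: hom_eta_inj.
  by rewrite lift_eta fmap_comp -compcA lift_eta !compcA lift_eta.
Defined.

Definition free_unit : NatTrans (idF C) (compF U free_functor).
Proof. by exists eta0 => A B f /=; rewrite lift_eta. Defined.

Definition free_counit : NatTrans (compF free_functor U) (idF D).
Proof.
exists (fun B : D => lift (U B) B (idc (U B))) => A B f /=.
apply: hom_eta_inj.
by rewrite !fmap_comp -!compcA !lift_eta !compcA lift_eta compc_idl compc_idr.
Defined.

Lemma free_adjunction : IsAdjunction free_unit free_counit.
Proof.
split=> [A|B] /=; last exact: lift_eta.
apply: hom_eta_inj.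
by rewrite fmap_comp -compcA lift_eta compcA lift_eta compc_idl fmap_id
  compc_idl.
Qed.

End UniversalArrows.

Lemma adjunction_monad (C D : Category) (F : Functor C D) (U : Functor D C)
    (eta : NatTrans (idF C) (compF U F)) (eps : NatTrans (compF F U) (idF D)) :
  IsAdjunction eta eps -> IsMonad eta (adj_mult eps).
Proof.
case=> triF triU; split=> A /=.
- by rewrite -!fmap_comp; congr fmap; exact: (nt_nat eps (eps (F A))).
- exact: triU.
- by rewrite -fmap_comp triF fmap_id.
Qed.

(** * Terms and their values *)

(** A stretching has two families of cells, those of the magma and those of the
    groupoid.  Both are reflexive magmas with reversors, so indexing by the
    layer lets one construction treat the operations that they share. *)
Inductive layer := Total | Base.

(** Raw expressions: no condition of composability or of parallelism is imposed
    on the arguments of [tcomp], [tbr] and [tcbr]. *)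
Inductive term (X : CSet) : layer -> nat -> Type :=
| tgen n : X n -> term X Total n
| tface l (r : side) n : 'I_n.+1 -> term X l n.+1 -> term X l n
| trefl l n : 'I_n.+1 -> term X l n -> term X l n.+1
| tconn l (g : sign) n : 'I_n.+1 -> term X l n.+1 -> term X l n.+2
| tcomp l n : 'I_n.+1 -> term X l n.+1 -> term X l n.+1 -> term X l n.+1
| trev l n : 'I_n.+1 -> term X l n.+1 -> term X l n.+1
| tpi n : term X Total n -> term X Base n
| tbr n : 'I_n.+1 -> term X Total n -> term X Total n -> term X Total n.+1
| tcbr (g : sign) n :
    'I_n.+1 -> term X Total n.+1 -> term X Total n.+1 -> term X Total n.+2.

Arguments tgen {X n} x.
Arguments tface {X l} r {n} j a.
Arguments trefl {X l n} j a.
Arguments tconn {X l} g {n} j a.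
Arguments tcomp {X l n} j a b.
Arguments trev {X l n} j a.
Arguments tpi {X n} a.
Arguments tbr {X n} j a b.
Arguments tcbr {X} g {n} j a b.

Definition tier (S : Stretching) (l : layer) : Magma0 :=
  match l with Total => stM S | Base => stC S end.

(** [den f t v]: the term [t] has the value [v] when the generators are
    interpreted by [f].  A relation is used because a term has no value when one
    of its partial operations is applied outside of its domain. *)
Fixpoint den {X : CSet} {S : Stretching} (f : CSetHom X (stM S)) {l n}
    (t : term X l n) : tier S l n -> Prop :=
  match t in term _ l n return tier S l n -> Prop with
  | tgen n x => fun v => v = f n x
  | tface l r n j a => fun v => exists2 x, den f a x & v = face r j x
  | trefl l n j a => fun v => exists2 x, den f a x & v = refl j x
  | tconn l g n j a => fun v => exists2 x, den f a x & v = conn g j x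
  | tcomp l n j a b => fun v =>
      exists x y h, [/\ den f a x, den f b y & v = comp j x y h]
  | trev l n j a => fun v => exists2 x, den f a x & v = rev j x
  | tpi n a => fun v => exists2 x, den f a x & v = stpi S n x
  | tbr n j a b => fun v =>
      exists x y h, [/\ den f a x, den f b y & v = br j x y h]
  | tcbr g n j a b => fun v =>
      exists x y h hs, [/\ den f a x, den f b y & v = cbr g j x y h hs]
  end.

Lemma den_fun X S (f : CSetHom X (stM S)) l n (t : term X l n) v w :
  den f t v -> den f t w -> v = w.
Proof.
elim: t v w => {l n} /=.
- by move=> n x v w -> ->.
- by move=> l r n j a IH v w [x hx ->] [y hy ->]; rewrite (IH x y).
- by move=> l n j a IH v w [x hx ->] [y hy ->]; rewrite (IH x y).
- by move=> l g n j a IH v w [x hx ->] [y hy ->]; rewrite (IH x y).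
- move=> l n j a IHa b IHb v w [x [y [h [hx hy ->]]]].
  move=> [x' [y' [h' [hx' hy' ->]]]].
  have ex := IHa _ _ hx hx'; have ey := IHb _ _ hy hy'; subst x' y'.
  by congr comp; apply: proof_irrelevance.
- by move=> l n j a IH v w [x hx ->] [y hy ->]; rewrite (IH x y).
- by move=> n a IH v w [x hx ->] [y hy ->]; rewrite (IH x y).
- move=> n j a IHa b IHb v w [x [y [h [hx hy ->]]]].
  move=> [x' [y' [h' [hx' hy' ->]]]].
  have ex := IHa _ _ hx hx'; have ey := IHb _ _ hy hy'; subst x' y'.
  by congr br; apply: proof_irrelevance.
- move=> g n j a IHa b IHb v w [x [y [h [hs [hx hy ->]]]]].
  move=> [x' [y' [h' [hs' [hx' hy' ->]]]]].
  have ex := IHa _ _ hx hx'; have ey := IHb _ _ hy hy'; subst x' y'.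
  by congr cbr; apply: proof_irrelevance.
Qed.

Definition sthom {S T : Stretching} (k : StretchingHom S T) (l : layer) :
    Magma0Hom (tier S l) (tier T l) :=
  match l with Total => sthomM k | Base => sthomC k end.

(** Morphisms commute with all operations, and map the domain of a partial
    operation into the corresponding domain, so they preserve values of terms
    in both layers. *)
Lemma den_hom X S T (k : StretchingHom S T) (f : CSetHom X (stM S))
    (f' : CSetHom X (stM T)) l n (t : term X l n) v :
  (forall m (x : X m), f' m x = sthomM k m (f m x)) ->
  den f t v -> den f' t (sthom k l n v).
Proof.
move=> ff'; elim: t v => {l n} /=.
- by move=> n x v ->.
- by move=> l r n j a IH v [x hx ->]; exists (sthom k l _ x);
    [exact: IH | exact: hmap_face].
- by move=> l n j a IH v [x hx ->]; exists (sthom k l _ x);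
    [exact: IH | exact: mhom_refl].
- by move=> l g n j a IH v [x hx ->]; exists (sthom k l _ x);
    [exact: IH | exact: mhom_conn].
- move=> l n j a IHa b IHb v [x [y [h [hx hy ->]]]].
  have [h' e] := mhom_comp _ _ (sthom k l) n j x y h.
  by exists (sthom k l _ x), (sthom k l _ y), h'; split;
    [exact: IHa | exact: IHb |].
- by move=> l n j a IH v [x hx ->]; exists (sthom k l _ x);
    [exact: IH | exact: m0hom_rev].
- by move=> n a IH v [x hx ->]; exists (sthomM k _ x);
    [exact: IH | rewrite sthom_pi].
- move=> n j a IHa b IHb v [x [y [h [hx hy ->]]]].
  have [h' e] := sthom_br _ _ k n j x y h.
  by exists (sthomM k _ x), (sthomM k _ y), h'; split;
    [exact: IHa | exact: IHb |].
- move=> g n j a IHa b IHb v [x [y [h [hs [hx hy ->]]]]].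
  have [h' [hs' e]] := sthom_cbr _ _ k g n j x y h hs.
  by exists (sthomM k _ x), (sthomM k _ y), h', hs'; split;
    [exact: IHa | exact: IHb |].
Qed.

(** * Cells of the free stretching *)

Section Free.

Variable X : CSet.

Definition defined {l n} (t : term X l n) : Prop :=
  forall S (f : CSetHom X (stM S)), exists v, den f t v.

(** For terms that are [defined], this says that [t] and [t'] have a common
    value along every [f]. *)
Definition same {l n} (t t' : term X l n) : Prop :=
  forall S (f : CSetHom X (stM S)) v, den f t v <-> den f t' v.

(** A chosen representative of each class of [same], which realizes the quotient
    by [same] as a subtype of the type of terms. *)
Definition canon {l n} (t : term X l n) : term X l n :=
  epsilon (inhabits t) (same t).

Lemma same_canon l n (t : term X l n) : same t (canon t).
Proof. by apply: (epsilon_spec (inhabits t) (same t)); exists t. Qed.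

(** Equivalent terms have extensionally equal classes, hence equal classes, and
    the choice operator then returns the same term. *)
Lemma canon_eq l n (t t' : term X l n) : same t t' -> canon t = canon t'.
Proof.
move=> tt'; rewrite /canon (_ : same t = same t').
  by congr epsilon; apply: proof_irrelevance.
apply: functional_extensionality => u; apply: propositional_extensionality.
by split=> h S f v; rewrite -h ?tt' // -tt'.
Qed.

Definition fcell (l : layer) (n : nat) : Type :=
  {t : term X l n | defined t /\ canon t = t}.

(** The class of a term. *)
Definition mk {l n} (t : term X l n) (ht : defined t) : fcell l n.
Proof.
exists (canon t); split.
- by move=> S f; have [v hv] := ht S f; exists v;
    apply: (proj1 (same_canon _ _ t S f v)).
- by rewrite -(canon_eq _ _ _ _ (same_canon _ _ t)).
Defined.

Definition value {S} (f : CSetHom X (stM S)) {l n} (q : fcell l n) :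
    tier S l n :=
  proj1_sig (constructive_indefinite_description _ (proj1 (proj2_sig q) S f)).

Lemma den_value S (f : CSetHom X (stM S)) l n (q : fcell l n) :
  den f (proj1_sig q) (value f q).
Proof. by rewrite /value; case: constructive_indefinite_description. Qed.

Lemma value_mk S (f : CSetHom X (stM S)) l n (t : term X l n) ht v :
  den f t v -> value f (mk t ht) = v.
Proof.
move=> hv; apply: den_fun (den_value _ _ _ _ _) _.
exact: (proj1 (same_canon _ _ t S f v)).
Qed.

(** The cells of the free stretching are separated by their values; this is what
    transfers equational axioms from all stretchings to the free one. *)
Lemma fcellP l n (p q : fcell l n) :
  (forall S (f : CSetHom X (stM S)), value f p = value f q) -> p = q.
Proof.
case: p q => [t [ht et]] [u [hu eu]] e.
apply: (eq_sig_hprop (fun _ _ _ => proof_irrelevance _ _ _)) => /=.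
rewrite -et -eu; apply: canon_eq => S f v.
have := den_value _ f _ _ (exist _ t (conj ht et)).
have := den_value _ f _ _ (exist _ u (conj hu eu)).
rewrite e /=; move: (value _ _) => w hw hw'.
by split=> h; [rewrite (den_fun _ _ _ _ _ _ _ _ h hw')
              | rewrite (den_fun _ _ _ _ _ _ _ _ h hw)].
Qed.

(** * Operations on the cells of the free stretching *)

Definition fgen {n} (x : X n) : fcell Total n.
Proof. by apply: (mk (tgen x)) => S f; exists (f n x). Defined.

Lemma value_gen S (f : CSetHom X (stM S)) n (x : X n) :
  value f (fgen x) = f n x.
Proof. exact: value_mk. Qed.

Definition fface {l} (r : side) {n} (j : 'I_n.+1) (q : fcell l n.+1) :
  fcell l n.
Proof.
apply: (mk (tface r j (proj1_sig q))) => S f.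
by exists (face r j (value f q)), (value f q) => //; exact: den_value.
Defined.

Lemma value_face S (f : CSetHom X (stM S)) l r n (j : 'I_n.+1)
    (q : fcell l n.+1) :
  value f (fface r j q) = face r j (value f q).
Proof. by apply: value_mk; exists (value f q) => //; exact: den_value. Qed.

Definition frefl {l n} (j : 'I_n.+1) (q : fcell l n) : fcell l n.+1.
Proof.
apply: (mk (trefl j (proj1_sig q))) => S f.
by exists (refl j (value f q)), (value f q) => //; exact: den_value.
Defined.

Lemma value_refl S (f : CSetHom X (stM S)) l n (j : 'I_n.+1) (q : fcell l n) :
  value f (frefl j q) = refl j (value f q).
Proof. by apply: value_mk; exists (value f q) => //; exact: den_value. Qed.

Definition fconn {l} (g : sign) {n} (j : 'I_n.+1) (q : fcell l n.+1) :
  fcell l n.+2.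
Proof.
apply: (mk (tconn g j (proj1_sig q))) => S f.
by exists (conn g j (value f q)), (value f q) => //; exact: den_value.
Defined.

Lemma value_conn S (f : CSetHom X (stM S)) l g n (j : 'I_n.+1)
    (q : fcell l n.+1) :
  value f (fconn g j q) = conn g j (value f q).
Proof. by apply: value_mk; exists (value f q) => //; exact: den_value. Qed.

Definition frev {l n} (j : 'I_n.+1) (q : fcell l n.+1) : fcell l n.+1.
Proof.
apply: (mk (trev j (proj1_sig q))) => S f.
by exists (rev j (value f q)), (value f q) => //; exact: den_value.
Defined.

Lemma value_rev S (f : CSetHom X (stM S)) l n (j : 'I_n.+1) (q : fcell l n.+1) :
  value f (frev j q) = rev j (value f q).
Proof. by apply: value_mk; exists (value f q) => //; exact: den_value. Qed.

Definition fpi {n} (q : fcell Total n) : fcell Base n.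
Proof.
apply: (mk (tpi (proj1_sig q))) => S f.
by exists (stpi S n (value f q)), (value f q) => //; exact: den_value.
Defined.

Lemma value_pi S (f : CSetHom X (stM S)) n (q : fcell Total n) :
  value f (fpi q) = stpi S n (value f q).
Proof. by apply: value_mk; exists (value f q) => //; exact: den_value. Qed.

Lemma value_composable S (f : CSetHom X (stM S)) l n (j : 'I_n.+1)
    (p q : fcell l n.+1) :
  fface Tgt j p = fface Src j q ->
  face Tgt j (value f p) = face Src j (value f q).
Proof. by move=> h; rewrite -!value_face h. Qed.

Definition fcomp {l n} (j : 'I_n.+1) (p q : fcell l n.+1)
    (h : fface Tgt j p = fface Src j q) : fcell l n.+1.
Proof.
apply: (mk (tcomp j (proj1_sig p) (proj1_sig q))) => S f.
exists (comp j _ _ (value_composable S f _ _ _ _ _ h)).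
by do 3 eexists; split; [exact: den_value | exact: den_value | reflexivity].
Defined.

Lemma value_comp S (f : CSetHom X (stM S)) l n (j : 'I_n.+1)
    (p q : fcell l n.+1) h :
  exists h', value f (fcomp j p q h) = comp j (value f p) (value f q) h'.
Proof.
exists (value_composable S f _ _ _ _ _ h); apply: value_mk.
by do 3 eexists; split; [exact: den_value | exact: den_value | reflexivity].
Qed.

(** The analogue of [fcellP] for a conclusion asserting that a composite exists:
    its domain condition is an equation between cells, which is checked on
    values. *)
Lemma fcompP l n (j : 'I_n.+1) (p q c : fcell l n.+1) :
  (forall S (f : CSetHom X (stM S)),
    exists h, value f c = comp j (value f p) (value f q) h) ->
  exists h, c = fcomp j p q h.
Proof.
move=> H; have h : fface Tgt j p = fface Src j q.
  by apply: fcellP => S f; rewrite !value_face; have [] := H S f.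
exists h; apply: fcellP => S f; have [h1 ->] := H S f.
have [h2 ->] := value_comp S f _ _ _ _ _ h.
by congr comp; apply: proof_irrelevance.
Qed.

Lemma fcompP_sym l n (j : 'I_n.+1) (p q c : fcell l n.+1) :
  (forall S (f : CSetHom X (stM S)),
    exists h, comp j (value f p) (value f q) h = value f c) ->
  exists h, fcomp j p q h = c.
Proof.
move=> H; have [|h e] := fcompP _ _ j p q c; last by exists h.
by move=> S f; have [h e] := H S f; exists h.
Qed.

(** [fcompP] for a composite of composites, as in the transport laws: the inner
    composites are formed first, so that the outer one can be compared with
    them. *)
Lemma fcomp2P l n (i j : 'I_n.+1) (a b a' b' c : fcell l n.+1) :
  (forall S (f : CSetHom X (stM S)), exists h h' h'',
    value f c = comp j (comp i (value f a) (value f b) h)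
                       (comp i (value f a') (value f b') h') h'') ->
  exists h h' h'', c = fcomp j (fcomp i a b h) (fcomp i a' b' h') h''.
Proof.
move=> H; have h : fface Tgt i a = fface Src i b.
  by apply: fcellP => S f; rewrite !value_face; have [] := H S f.
have h' : fface Tgt i a' = fface Src i b'.
  by apply: fcellP => S f; rewrite !value_face; have [? []] := H S f.
exists h, h'; apply: fcompP => S f; have [k [k' [k'' ->]]] := H S f.
have [m ->] := value_comp S f _ _ _ _ _ h.
have [m' ->] := value_comp S f _ _ _ _ _ h'.
by rewrite (proof_irrelevance _ m k) (proof_irrelevance _ m' k'); exists k''.
Qed.

(** * The two layers of the free stretching *)

Definition fcset (l : layer) : CSet.
Proof.
exists (fcell l) (@fface l).
by move=> *; apply: fcellP => S f; rewrite !value_face; apply: face_face.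
Defined.

Definition frcset (l : layer) : RCSet.
Proof.
exists (fcset l) (@frefl l) (@fconn l) => /=.
- by move=> *; apply: fcellP => S f; rewrite !value_refl;
    apply: refl_refl.
- by move=> *; apply: fcellP => S f; rewrite !(value_refl, value_face);
    apply: face_refl_lt.
- by move=> *; apply: fcellP => S f; rewrite !(value_refl, value_face);
    apply: face_refl_gt.
- by move=> *; apply: fcellP => S f; rewrite !(value_refl, value_face);
    apply: face_refl_eq.
- by move=> *; apply: fcellP => S f; rewrite !value_conn;
    apply: conn_conn_lt.
- by move=> *; apply: fcellP => S f; rewrite !value_conn;
    apply: conn_conn_eq.
- by move=> *; apply: fcellP => S f; rewrite !(value_refl, value_conn);
    apply: conn_refl_lt.
- by move=> *; apply: fcellP => S f; rewrite !(value_refl, value_conn);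
    apply: conn_refl_gt.
- by move=> *; apply: fcellP => S f; rewrite !(value_refl, value_conn);
    apply: conn_refl_eq.
- by move=> *; apply: fcellP => S f; rewrite !(value_face, value_conn);
    apply: face_conn_lt.
- by move=> *; apply: fcellP => S f; rewrite !(value_face, value_conn);
    apply: face_conn_gt.
- by move=> g n j x hj; split; apply: fcellP => S f;
    rewrite !(value_face, value_conn);
    have [] := face_conn_side _ g n j (value f x) hj.
- by move=> g n j x hj; split; apply: fcellP => S f;
    rewrite !(value_face, value_conn, value_refl);
    have [] := face_conn_coside _ g n j (value f x) hj.
Defined.

Definition fmagma (l : layer) : Magma.
Proof.
exists (frcset l) (@fcomp l) => /=.
- move=> n j a b h; apply: fcellP => S f; rewrite !value_face.
  by have [h' ->] := value_comp S f _ _ _ _ _ h; exact: src_comp.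
- move=> n j a b h; apply: fcellP => S f; rewrite !value_face.
  by have [h' ->] := value_comp S f _ _ _ _ _ h; exact: tgt_comp.
- move=> r n i j a b h hi hj; apply: fcompP => S f; rewrite !value_face.
  by have [h' ->] := value_comp S f _ _ _ _ _ h; exact: face_comp_lt.
- move=> r n i j a b h hi hj; apply: fcompP => S f; rewrite !value_face.
  by have [h' ->] := value_comp S f _ _ _ _ _ h; exact: face_comp_gt.
Defined.

Definition fmagma0 (l : layer) : Magma0.
Proof.
exists (fmagma l); exists (@frev l) => /= n j x; apply: fcellP => S f;
  rewrite !(value_face, value_rev); [exact: tgt_reversor | exact: src_reversor].
Defined.

Definition fcat : StrictCat.
Proof.
exists (fmagma Base) => /=.
- move=> n j a b c hab hbc.
  (* Both sides contain composites of cells of the free stretching, so the law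
     is first stated on the values of these inner composites. *)
  have H S (f : CSetHom X (stM S)) : exists h h',
      comp j (value f (fcomp j a b hab)) (value f c) h
        = comp j (value f a) (value f (fcomp j b c hbc)) h'.
    have [h1 ->] := value_comp S f _ _ _ _ _ hab.
    have [h2 ->] := value_comp S f _ _ _ _ _ hbc.
    exact: (sc_assoc (stC S)).
  have h : fface Tgt j (fcomp j a b hab) = fface Src j c.
    by apply: fcellP => S f; rewrite !value_face; have [] := H S f.
  exists h; apply: fcompP => S f; have [h1 ->] := value_comp S f _ _ _ _ _ h.
  have [h2 [h3 e]] := H S f; exists h3; rewrite -e.
  by congr comp; apply: proof_irrelevance.
- move=> n j a; apply: fcompP_sym => S f; rewrite value_refl value_face.
  exact: (sc_unitl (stC S)).
- move=> n j a; apply: fcompP_sym => S f; rewrite value_refl value_face.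
  exact: (sc_unitr (stC S)).
- move=> n i j a b c d hab hcd hac hbd h h' ij; apply: fcellP => S f.
  have [k ->] := value_comp S f _ _ _ _ _ h.
  have [k' ->] := value_comp S f _ _ _ _ _ h'; move: k k'.
  have [h1 ->] := value_comp S f _ _ _ _ _ hab.
  have [h2 ->] := value_comp S f _ _ _ _ _ hcd.
  have [h3 ->] := value_comp S f _ _ _ _ _ hac.
  have [h4 ->] := value_comp S f _ _ _ _ _ hbd.
  by move=> k k'; apply: (sc_interchange (stC S)).
- move=> n i j a b h hi hj; apply: fcompP => S f; rewrite !value_refl.
  have [h' ->] := value_comp S f _ _ _ _ _ h.
  exact: (sc_refl_comp_le (stC S)).
- move=> n i j a b h hi hj; apply: fcompP => S f; rewrite !value_refl.
  have [h' ->] := value_comp S f _ _ _ _ _ h.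
  exact: (sc_refl_comp_gt (stC S)).
- move=> g n i j a b h hi hj; apply: fcompP => S f; rewrite !value_conn.
  have [h' ->] := value_comp S f _ _ _ _ _ h.
  exact: (sc_conn_comp_lt (stC S)).
- move=> g n i j a b h hi hj; apply: fcompP => S f; rewrite !value_conn.
  have [h' ->] := value_comp S f _ _ _ _ _ h.
  exact: (sc_conn_comp_gt (stC S)).
- move=> n j a b h hj; apply: fcomp2P => S f; rewrite !(value_conn, value_refl).
  have [k ->] := value_comp S f _ _ _ _ _ h.
  exact: (sc_transport_plus (stC S)).
- move=> n j a b h hj; apply: fcomp2P => S f; rewrite !(value_conn, value_refl).
  have [k ->] := value_comp S f _ _ _ _ _ h.
  exact: (sc_transport_minus (stC S)).
- move=> n i x hi; apply: fcompP_sym => S f; rewrite !(value_conn, value_refl).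
  exact: (sc_conn_conn (stC S)).
- move=> n i x hi; apply: fcompP_sym => S f; rewrite !(value_conn, value_refl).
  exact: (sc_conn_conn_succ (stC S)).
Defined.

Definition fgroupoid : Groupoid.
Proof.
exists fcat (m0rev (fmagma0 Base)) => /= n j x; apply: fcompP_sym => S f;
  rewrite value_rev value_refl value_face.
- exact: (grev_invr (stC S)).
- exact: (grev_invl (stC S)).
Defined.

Definition fproj : Magma0Hom (fmagma0 Total) fgroupoid.
Proof.
unshelve refine (Build_Magma0Hom (fmagma0 Total) fgroupoid
  (Build_MagmaHom (fmagma Total) fcat
     (Build_CSetHom (fcset Total) (fcset Base) (@fpi) _) _ _ _) _) => /=.
- move=> r n j x; apply: fcellP => S f.
  by rewrite !(value_pi, value_face); exact: hmap_face.
- move=> n j x; apply: fcellP => S f.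
  by rewrite !(value_pi, value_refl); exact: mhom_refl.
- move=> g n j x; apply: fcellP => S f.
  by rewrite !(value_pi, value_conn); exact: mhom_conn.
- move=> n j a b h; apply: fcompP => S f; rewrite !value_pi.
  by have [h' ->] := value_comp S f _ _ _ _ _ h; exact: mhom_comp.
- move=> n j x; apply: fcellP => S f.
  rewrite value_pi [in LHS]value_rev [in RHS]value_rev value_pi.
  exact: m0hom_rev.
Defined.

(** * Brackets of the free stretching *)

Lemma value_parallel S (f : CSetHom X (stM S)) n (p q : fcell Total n) :
  parallel fproj p q -> parallel (stpi S) (value f p) (value f q).
Proof.
case: n p q => [|n] p q /= h; first by rewrite h.
by rewrite -!value_pi h.
Qed.

(** Parallelism is an equation between cells of the total or of the base layer,
    according to the dimension. *)
Lemma parallelP n (p q : fcell Total n) :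
  (forall S (f : CSetHom X (stM S)),
    parallel (stpi S) (value f p) (value f q)) ->
  parallel fproj p q.
Proof.
case: n p q => [|n] p q /= h; apply: fcellP => S f; first exact: h.
by rewrite !value_pi; exact: h.
Qed.

Definition fbr {n} (j : 'I_n.+1) (p q : fcell Total n)
    (h : parallel fproj p q) : fcell Total n.+1.
Proof.
apply: (mk (tbr j (proj1_sig p) (proj1_sig q))) => S f.
exists (br j _ _ (value_parallel S f _ _ _ h)).
by do 3 eexists; split; [exact: den_value | exact: den_value | reflexivity].
Defined.

Lemma value_br S (f : CSetHom X (stM S)) n (j : 'I_n.+1)
    (p q : fcell Total n) h :
  exists h', value f (fbr j p q h) = br j (value f p) (value f q) h'.
Proof.
exists (value_parallel S f _ _ _ h); apply: value_mk.
by do 3 eexists; split; [exact: den_value | exact: den_value | reflexivity].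
Qed.

(** The analogue of [fcompP] for brackets. *)
Lemma fbrP n (j : 'I_n.+1) (p q : fcell Total n) (c : fcell Total n.+1) :
  (forall S (f : CSetHom X (stM S)),
    exists h, value f c = br j (value f p) (value f q) h) ->
  exists h, c = fbr j p q h.
Proof.
move=> H; have h : parallel fproj p q.
  by apply: parallelP => S f; have [] := H S f.
exists h; apply: fcellP => S f; have [h1 ->] := H S f.
by have [h2 ->] := value_br S f _ j _ _ h; rewrite (proof_irrelevance _ h2 h1).
Qed.

Lemma value_face_eq S (f : CSetHom X (stM S)) r n (j : 'I_n.+1)
    (p q : fcell Total n.+1) :
  fface r j p = fface r j q -> face r j (value f p) = face r j (value f q).
Proof. by move=> h; rewrite -!value_face h. Qed.

Definition fcbr g {n} (j : 'I_n.+1) (p q : fcell Total n.+1)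
    (h : parallel fproj p q)
    (hs : fface (side_of g) j p = fface (side_of g) j q) : fcell Total n.+2.
Proof.
apply: (mk (tcbr g j (proj1_sig p) (proj1_sig q))) => S f.
exists (cbr g j _ _ (value_parallel S f _ _ _ h)
  (value_face_eq S f _ _ _ _ _ hs)).
by do 4 eexists; split; [exact: den_value | exact: den_value | reflexivity].
Defined.

Lemma value_cbr S (f : CSetHom X (stM S)) g n (j : 'I_n.+1)
    (p q : fcell Total n.+1) h hs :
  exists h' hs',
    value f (fcbr g j p q h hs) = cbr g j (value f p) (value f q) h' hs'.
Proof.
exists (value_parallel S f _ _ _ h), (value_face_eq S f _ _ _ _ _ hs).
apply: value_mk.
by do 4 eexists; split; [exact: den_value | exact: den_value | reflexivity].
Qed.

Lemma fcbrP g n (j : 'I_n.+1) (p q : fcell Total n.+1) (c : fcell Total n.+2) :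
  (forall S (f : CSetHom X (stM S)),
    exists h hs, value f c = cbr g j (value f p) (value f q) h hs) ->
  exists h hs, c = fcbr g j p q h hs.
Proof.
move=> H; have h : parallel fproj p q.
  by apply: parallelP => S f; have [] := H S f.
have hs : fface (side_of g) j p = fface (side_of g) j q.
  by apply: fcellP => S f; rewrite !value_face; have [? []] := H S f.
exists h, hs; apply: fcellP => S f; have [h1 [hs1 ->]] := H S f.
have [h2 [hs2 ->]] := value_cbr S f _ _ _ _ _ h hs.
by congr cbr; apply: proof_irrelevance.
Qed.

Definition fstretching : Stretching.
Proof.
exists (fmagma0 Total) fgroupoid fproj (@fbr) (@fcbr) => /=.
- move=> r n i j a b h hi hj; apply: fbrP => S f; rewrite !value_face.
  by have [h' ->] := value_br S f _ (ix j) a b h; exact: face_br_lt.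
- move=> r n i j a b h hi hj; apply: fbrP => S f; rewrite !value_face.
  by have [h' ->] := value_br S f _ (ix j) a b h; exact: face_br_gt.
- move=> n j a b h; apply: fcellP => S f; rewrite value_face.
  by have [h' ->] := value_br S f _ j a b h; exact: src_br.
- move=> n j a b h; apply: fcellP => S f; rewrite value_face.
  by have [h' ->] := value_br S f _ j a b h; exact: tgt_br.
- by move=> n j a b h; split; apply: fcellP => S f;
    rewrite value_refl !value_pi;
    have [h' ->] := value_br S f _ j a b h; have [] := pi_br S n j _ _ h'.
- move=> n j a; have [|h e] := fbrP _ j a a (frefl j a); last by exists h.
  move=> S f; rewrite value_refl.
  by have [h e] := br_diag S n j (value f a); exists h.
- by move=> g n j a b h hs hj; split; apply: fcellP => S f; rewrite value_face;
    have [h' [hs' ->]] := value_cbr S f _ _ _ a b h hs;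
    have [] := face_cbr_side S g n j _ _ h' hs' hj.
- move=> g n j a b h hs hj.
  (* The two faces must equal one and the same bracket: it is obtained from the
     first face, and the second face is then compared with the first. *)
  have H S (f : CSetHom X (stM S)) := face_cbr_coside S g n j _ _
    (value_parallel S f _ a b h) (value_face_eq S f _ _ _ _ _ hs) hj.
  have vH S (f : CSetHom X (stM S)) : value f (fcbr g (ix j) a b h hs)
      = cbr g (ix j) _ _ (value_parallel S f _ a b h)
          (value_face_eq S f _ _ _ _ _ hs).
    have [h' [hs' ->]] := value_cbr S f _ _ _ a b h hs.
    by congr cbr; apply: proof_irrelevance.
  have [|h1 e1] := fbrP _ (ix j) (fface (coside_of g) (ix j) a)
      (fface (coside_of g) (ix j) b)
      (fface (coside_of g) (ix j) (fcbr g (ix j) a b h hs)).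
    by move=> S f; rewrite !value_face vH; have [h' [e _]] := H S f; exists h'.
  exists h1; split=> //; rewrite -e1; apply: fcellP => S f.
  by rewrite !value_face vH; have [h' [-> ->]] := H S f.
- move=> r g n i j a b h hs hi hj; apply: fcbrP => S f; rewrite !value_face.
  by have [h' [hs' ->]] := value_cbr S f _ _ _ a b h hs; exact: face_cbr_lt.
- move=> r g n i j a b h hs hi hj; apply: fcbrP => S f; rewrite !value_face.
  by have [h' [hs' ->]] := value_cbr S f _ _ _ a b h hs; exact: face_cbr_gt.
- by move=> g n j a b h hs; split; apply: fcellP => S f;
    rewrite value_conn !value_pi;
    have [h' [hs' ->]] := value_cbr S f _ _ _ a b h hs;
    have [] := pi_cbr S g n j _ _ h' hs'.
- move=> g n j a; have [|h [hs e]] := fcbrP g _ j a a (fconn g j a).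
    move=> S f; rewrite value_conn.
    by have [h [hs e]] := cbr_diag S g n j (value f a); exists h, hs.
  by exists h, hs.
Defined.

(** * The universal property *)

Definition unit_hom : CSetHom X (stM fstretching).
Proof.
exists (@fgen) => r n j x /=; apply: fcellP => S f.
by rewrite value_face !value_gen hmap_face.
Defined.

Definition value_hom {S : Stretching} (f : CSetHom X (stM S)) l :
  Magma0Hom (fmagma0 l) (tier S l).
Proof.
unshelve refine (Build_Magma0Hom (fmagma0 l) (tier S l)
  (Build_MagmaHom (fmagma l) (tier S l)
     (Build_CSetHom (fcset l) (tier S l) (@value S f l) _) _ _ _) _) => /=.
- by move=> r n j x; rewrite value_face.
- by move=> n j x; rewrite value_refl.
- by move=> g n j x; rewrite value_conn.
- by move=> n j a b h; exact: value_comp.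
- by move=> n j x; exact: value_rev.
Defined.

Definition ext_hom {S : Stretching} (f : CSetHom X (stM S)) :
  StretchingHom fstretching S.
Proof.
exists (value_hom f Total) (value_hom f Base) => /=.
- by move=> n x; rewrite value_pi.
- by move=> n j a b h; exact: value_br.
- by move=> g n j a b h hs; exact: value_cbr.
Defined.

(** The free stretching being one of the stretchings quantified over in
    [defined], a representative of [q] has some value [v] along the unit.  For
    every [f], the morphism extending [f] sends [v] to the value of this
    representative along [f], which is the value of [q]; so [v] and [q] have the
    same values and are equal. *)
Lemma den_unit l n (q : tier fstretching l n) :
  exists t : term X l n, den unit_hom t q.
Proof.
have efg : forall m (x : X m) S (f : CSetHom X (stM S)),
    f m x = sthomM (ext_hom f) m (unit_hom m x).
  by move=> m x S f; rewrite /= value_gen.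
have main (p : fcell l n) v : den unit_hom (proj1_sig p) v ->
    forall S (f : CSetHom X (stM S)), sthom (ext_hom f) l n v = value f p.
  move=> hv S f; apply: den_fun (den_value _ f _ _ p).
  by apply: den_hom hv => m x; exact: efg.
(* [tier fstretching l] is the layer [fmagma0 l] by computation once [l] is
   known. *)
case: l q main => q main; exists (proj1_sig q);
  have [v hv] := proj1 (proj2_sig q) fstretching unit_hom;
  (suff e : v = q by rewrite e in hv);
  by apply: fcellP => S f; rewrite -(main q v hv).
Qed.

(** Every cell is the value of a term in the generators, so its image under a
    morphism is the value of that term along the restriction of the morphism to
    the generators; this covers the base layer too, although no generator lies
    in it. *)
Lemma hom_unit_inj S (k k' : StretchingHom fstretching S) :
  (forall n (x : X n),
    sthomM k n (unit_hom n x) = sthomM k' n (unit_hom n x)) ->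
  k = k'.
Proof.
move=> e; have H l n (q : tier fstretching l n) :
    sthom k l n q = sthom k' l n q.
  have [t ht] := den_unit l n q.
  have hk := den_hom X fstretching S k unit_hom
    (CSetHom_comp (sthomM k) unit_hom) l n t q (fun _ _ => erefl _) ht.
  by apply: den_fun hk _; apply: (den_hom _ _ _ _ unit_hom).
apply: StretchingHom_eq; apply: Magma0Hom_eq.
- exact: (H Total).
- exact: (H Base).
Qed.

End Free.

Theorem mainTheorem4 :
  exists (F : Functor CSets EtG)
         (eta : NatTrans (idF CSets) (compF forgetful F))
         (eps : NatTrans (compF F forgetful) (idF EtG)),
    IsAdjunction eta eps /\ IsMonad eta (adj_mult eps).
Proof.
have lift_eta (A : CSets) (B : EtG) (f : Hom A (forgetful B)) :
    fmap forgetful (ext_hom A f : Hom (fstretching A : EtG) B) ∘ unit_hom A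
    = f.
  by apply: CSetHom_eq => n x; exact: value_gen.
have inj (A : CSets) (B : EtG) (g h : Hom (fstretching A : EtG) B) :
    fmap forgetful g ∘ unit_hom A = fmap forgetful h ∘ unit_hom A -> g = h.
  move=> e; apply: hom_unit_inj => n x.
  exact: (congr1 (fun u : CSetHom A (stM B) => u n x) e).
have adj :=
  free_adjunction CSets EtG forgetful fstretching unit_hom _ lift_eta inj.
do 3 eexists; split; [exact: adj | exact: (adjunction_monad _ _ _ _ _ _ adj)].
Qed.
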